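(* Let $\hbar>0$, $\delta\in\mathbb{R}$, let $\mathcal{F}$ be an $\hbar$-invariant $\ast$-subalgebra of $F(\mathbb{R},\mathbb{C})$ separating points of $\mathbb{R}$, and let $f\in\mathcal{F}$ be such that the functions $u\mapsto f(u\pm\tfrac12\hbar)$ belong to $\mathcal{F}$. Let $\mathcal{A}_\hbar(\mathcal{F},f)$ be the shift subalgebra generated by $A_+=f(u-\tfrac12\hbar)U^{-1}$ and $A_-=f(u+\tfrac12\hbar)U$, and for $k\in\mathbb{Z}$ let $\mathcal{S}_\hbar^\delta(|k\rangle)$ be the $\mathcal{A}_\hbar(\mathcal{F},f)$-module generated by $|k\rangle$ in $\mathcal{S}_\hbar(\mathbb{1},\delta)$. (1) If $f\big((N+\tfrac12+\delta)\hbar\big)=0$ for some $N\in\mathbb{Z}$ and $f\big((n+\tfrac12+\delta)\hbar\big)\ne0$ for all integers $n<N$, then $\mathcal{S}_\hbar^\delta(|N\rangle)=\{\sum_{n\le N}v_n|n\rangle: v_n\in\mathbb{C},\ v_n\neq 0\text{ for only finitely many }n\}$. (2) If $f\big((M-\tfrac12+\delta)\hbar\big)=0$ for some $M\in\mathbb{Z}$ and $f\big((n-\tfrac12+\delta)\hbar\big)\ne0$ for all integers $n>M$, then $\mathcal{S}_\hbar^\delta(|M\rangle)=\{\sum_{n\ge M}v_n|n\rangle: v_n\in\mathbb{C},\ v_n\neq 0\text{ for only finitely many }n\}$. (3) If $f\big((M-\tfrac12+\delta)\hbar\big)=0$ and $f\big((N+\tfrac12+\delta)\hbar\big)=0$ for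 some $M,N\in\mathbb{Z}$ with $M<N$, and $f\big((n+\tfrac12+\delta)\hbar\big)\ne0$ for all integers $M\le n<N$, then $\mathcal{S}_\hbar^\delta(|M\rangle)=\mathcal{S}_\hbar^\delta(|N\rangle)=\{\sum_{M\le n\le N}v_n|n\rangle: v_n\in\mathbb{C}\}$.
   Context: $F(\mathbb{R},\mathbb{C})$ is the $\ast$-algebra of all complex valued functions on $\mathbb{R}$ (involution = complex conjugation). A $\ast$-subalgebra $\mathcal{F}$ is $\hbar$-invariant if $u\mapsto g(u+k\hbar)$ is in $\mathcal{F}$ for all $g\in\mathcal{F}$, $k\in\mathbb{Z}$; it separates points if for distinct $x,y\in\mathbb{R}$ there is $g\in\mathcal{F}$ with $g(x)\neq g(y)$. The (one-dimensional) shift algebra consists of finite formal sums $\sum_{k\in\mathbb{Z}}f_kU^k$, $f_k\in\mathcal{F}$, with product $(f_kU^k)(g_lU^l)=f_k(u)g_l(u+k\hbar)U^{k+l}$ and involution $(f_kU^k)^\ast=\overline{f_k(u-k\hbar)}\,U^{-k}$, extended additively. A shift subalgebra is a $\ast$-subalgebra $\mathcal{A}$ of it such that $ga\in\mathcal{A}$ for all $g\in\mathcal{F}$, $a\in\mathcal{A}$; the shift subalgebra generated by a set is the smallest one containing it. $\mathcal{S}_\hbar(\mathbb{1},\delta)$ is the left module over the shift algebra with vector space basis $\{|k\rangle\}_{k\in\mathbb{Z}}$ and action $(\sum_nf_nU^n)|k\rangle=\sum_nf_n\big((k-n+\delta)\hbar\big)|k-n\rangle$. The $\mathcal{A}$-module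 generated by $|k\rangle$ is the smallest $\mathcal{A}$-invariant linear subspace containing $|k\rangle$. In particular $A_+|n\rangle=f\big((n+\tfrac12+\delta)\hbar\big)|n+1\rangle$ and $A_-|n\rangle=f\big((n-\tfrac12+\delta)\hbar\big)|n-1\rangle$. *)

(* Defs.v *)
From HB Require Import structures.
From mathcomp Require Import all_boot all_order all_algebra ring.
From mathcomp Require Import finmap.
From mathcomp Require Import boolp classical_sets functions reals.
From mathcomp Require Import complex.
From mathcomp.multinomials Require Import monalg.

Set Implicit Arguments.
Unset Strict Implicit.
Unset Printing Implicit Defensive.

Import Order.TTheory GRing.Theory Num.Theory.

Local Open Scope classical_set_scope.
Local Open Scope ring_scope.

(* Neither *-subalgebras of functions nor shift subalgebras are required to  *)
(* contain a unit.                                                            *)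
Definition star_subalgebra (R : realType) (F : set (R -> R[i])) : Prop :=
  [/\ F (fun=> 0),
      forall g h, F g -> F h -> F (fun u => g u + h u),
      forall (c : R[i]) g, F g -> F (fun u => c * g u),
      forall g h, F g -> F h -> F (fun u => g u * h u)
    & forall g, F g -> F (fun u => (g u)^*)].

Definition hbar_invariant (R : realType) (hbar : R) (F : set (R -> R[i])) :
    Prop :=
  forall g (k : int), F g -> F (fun u => g (u + k%:~R * hbar)).

Definition separates_points (R : realType) (F : set (R -> R[i])) : Prop :=
  forall x y : R, x <> y -> exists2 g, F g & g x <> g y.

(* The finite formal sum \sum_k f_k U^k is the finitely supported function    *)
(* k |-> f_k, so that << f *g k >> is f U^k and a@_k is the coefficient of    *)
(* U^k in a. Coefficients are arbitrary functions here; shift_algebra F below *)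
(* is the set of the sums with coefficients in F. The ring structure that     *)
(* monalg puts on some {malg _[_]} is not used: the product is twisted.       *)
Definition shift_sum (R : realType) := {malg (R -> R[i])[int]}.

Section ShiftOperations.
Variables (R : realType) (hbar : R).
Implicit Types a b : shift_sum R.

Definition shift_mul a b : shift_sum R :=
  \sum_(k <- msupp a) \sum_(l <- msupp b)
    << (fun u : R => a@_k u * b@_l (u + k%:~R * hbar)) *g k + l >>.

Definition shift_star a : shift_sum R :=
  \sum_(k <- msupp a)
    << (fun u : R => (a@_k (u - k%:~R * hbar))^*) *g - k >>.

(* g a, that is (g U^0) a *)
Definition shift_lmul (g : R -> R[i]) a : shift_sum R :=
  shift_mul << g *g 0 >> a.

Definition shift_algebra (F : set (R -> R[i])) : set (shift_sum R) :=
  [set a | forall k, F a@_k].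

Definition shift_subalgebra (F : set (R -> R[i])) (A : set (shift_sum R)) :
    Prop :=
  A `<=` shift_algebra F /\
  [/\ A 0,
      forall a b, A a -> A b -> A (a + b),
      forall (c : R[i]) a, A a -> A (shift_lmul (fun=> c) a),
      forall a b, A a -> A b -> A (shift_mul a b)
    & forall a, A a -> A (shift_star a)] /\
  forall g a, F g -> A a -> A (shift_lmul g a).

Definition generated_shift_subalgebra (F : set (R -> R[i]))
    (X : set (shift_sum R)) : set (shift_sum R) :=
  smallest (shift_subalgebra F) X.

Definition Aplus (f : R -> R[i]) : shift_sum R :=
  << (fun u : R => f (u - 2^-1 * hbar)) *g -1 >>.

Definition Aminus (f : R -> R[i]) : shift_sum R :=
  << (fun u : R => f (u + 2^-1 * hbar)) *g 1 >>.

Definition Ahbar (F : set (R -> R[i])) (f : R -> R[i]) : set (shift_sum R) :=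
  generated_shift_subalgebra F [set a | a = Aplus f \/ a = Aminus f].

End ShiftOperations.

(* The vector space with basis (|k>)_(k : int). *)
Definition ket_space (R : realType) := {malg R[i][int]}.

Definition ket (R : realType) (k : int) : ket_space R := << (1 : R[i]) *g k >>.

Section KetModule.
Variables (R : realType) (hbar delta : R).
Implicit Types (a : shift_sum R) (v : ket_space R).

Definition ket_act a v : ket_space R :=
  \sum_(k <- msupp v)
    v@_k *: \sum_(n <- msupp a)
              a@_n (((k - n)%:~R + delta) * hbar) *: ket R (k - n).

Definition invariant_subspace (A : set (shift_sum R)) (V : set (ket_space R)) :
    Prop :=
  [/\ V 0,
      forall v w, V v -> V w -> V (v + w),
      forall (c : R[i]) v, V v -> V (c *: v)
    & forall a v, A a -> V v -> V (ket_act a v)].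

Definition ket_module (F : set (R -> R[i])) (f : R -> R[i]) (k : int) :
    set (ket_space R) :=
  smallest (invariant_subspace (Ahbar hbar F f)) [set ket R k].

End KetModule.

(* All the finite sums \sum_n v_n |n> over the n satisfying P. *)
Definition ket_sums (R : realType) (P : set int) : set (ket_space R) :=
  [set v : ket_space R | forall n, v@_n != 0 -> P n].

(* The operations are the (bi)additive extensions of the formulas that define *)
(* them on monomials.                                                         *)
Section OperationFormulas.
Variables (R : realType) (hbar delta : R).

Lemma sum_msuppw (K : choiceType) (G V : zmodType) (F : K -> G -> V)
    (g : {malg G[K]}) (d : {fset K}) :
  (forall k, F k 0 = 0) -> (msupp g `<=` d)%fset ->
  \sum_(k <- msupp g) F k g@_k = \sum_(k <- d) F k g@_k.
Proof.
move=> F0 sgd; apply/big_fset_incl => // k _ /mcoeff_outdom ->; exact: F0.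
Qed.

Lemma sum_msuppD (K : choiceType) (G V : zmodType) (F : K -> G -> V)
    (g h : {malg G[K]}) :
  (forall k, F k 0 = 0) -> (forall k x y, F k (x + y) = F k x + F k y) ->
  \sum_(k <- msupp (g + h)) F k (g + h)@_k =
  \sum_(k <- msupp g) F k g@_k + \sum_(k <- msupp h) F k h@_k.
Proof.
move=> F0 FD.
rewrite (sum_msuppw F0 (msuppD_le g h)) (sum_msuppw F0 (fsubsetUl _ (msupp h))).
rewrite (sum_msuppw F0 (fsubsetUr (msupp g) _)) -big_split /=.
by apply: eq_bigr => k _; rewrite mcoeffD FD.
Qed.

Lemma sum_msuppU (K : choiceType) (G V : zmodType) (F : K -> G -> V) k x :
  (forall k, F k 0 = 0) ->
  \sum_(j <- msupp << x *g k >>) F j (<< x *g k >>)@_j = F k x.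
Proof.
move=> F0; rewrite (sum_msuppw F0 msuppU_le) big_seq_fset1 mcoeffUU //.
Qed.

Let mulF (k l : int) (g h : R -> R[i]) : shift_sum R :=
  << (fun u : R => g u * h (u + k%:~R * hbar)) *g k + l >>.

Let mulF0l k l h : mulF k l 0 h = 0.
Proof.
rewrite /mulF -[RHS](monalgU0 (k + l)); congr mkmalgU.
by apply/funext => u; rewrite mul0r.
Qed.

Let mulF0r k l g : mulF k l g 0 = 0.
Proof.
rewrite /mulF -[RHS](monalgU0 (k + l)); congr mkmalgU.
by apply/funext => u; rewrite mulr0.
Qed.

Let mulFDl k l g1 g2 h : mulF k l (g1 + g2) h = mulF k l g1 h + mulF k l g2 h.
Proof.
rewrite /mulF -monalgUD; congr mkmalgU.
by apply/funext => u; rewrite mulrDl.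
Qed.

Let mulFDr k l g h1 h2 : mulF k l g (h1 + h2) = mulF k l g h1 + mulF k l g h2.
Proof.
rewrite /mulF -monalgUD; congr mkmalgU.
by apply/funext => u; rewrite mulrDr.
Qed.

Lemma shift_mulUU k l (g h : R -> R[i]) :
  shift_mul hbar << g *g k >> << h *g l >> =
  << (fun u : R => g u * h (u + k%:~R * hbar)) *g k + l >>.
Proof.
rewrite /shift_mul.
rewrite (@sum_msuppU _ _ _ (fun k x => \sum_(l' <- msupp << h *g l >>)
  mulF k l' x (<< h *g l >>)@_l')).
  by rewrite (@sum_msuppU _ _ _ (fun l' y => mulF k l' g y)).
by move=> k'; rewrite big1 // => l' _; rewrite mulF0l.
Qed.

Lemma shift_mulDl : left_distributive (@shift_mul R hbar) +%R.
Proof.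
move=> a1 a2 b; apply: (@sum_msuppD _ _ _ (fun k x => \sum_(l <- msupp b)
  mulF k l x b@_l)) => [k | k x y].
  by rewrite big1 // => l _; rewrite mulF0l.
by rewrite -big_split; apply: eq_bigr => l _; rewrite mulFDl.
Qed.

Lemma shift_mulDr : right_distributive (@shift_mul R hbar) +%R.
Proof.
move=> a b1 b2; rewrite /shift_mul -big_split; apply: eq_bigr => k _ /=.
apply: (@sum_msuppD _ _ _ (fun l y => mulF k l a@_k y)) => [l | l x y].
  by rewrite mulF0r.
by rewrite mulFDr.
Qed.

Lemma shift_starU k (g : R -> R[i]) :
  shift_star hbar << g *g k >> =
  << (fun u : R => (g (u - k%:~R * hbar))^*) *g - k >>.
Proof.
apply: (@sum_msuppU _ _ _ (fun k g =>
  << (fun u : R => (g (u - k%:~R * hbar))^*) *g - k >> : shift_sum R)) => l.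
rewrite -[RHS](monalgU0 (- l)); congr mkmalgU.
by apply/funext => u; rewrite rmorph0.
Qed.

Lemma shift_starD : {morph @shift_star R hbar : a b / a + b}.
Proof.
move=> a b; apply: (@sum_msuppD _ _ _ (fun k g =>
  << (fun u : R => (g (u - k%:~R * hbar))^*) *g - k >> : shift_sum R)).
  move=> l; rewrite -[RHS](monalgU0 (- l)); congr mkmalgU.
  by apply/funext => u; rewrite rmorph0.
move=> l x y; rewrite -monalgUD; congr mkmalgU.
by apply/funext => u; rewrite rmorphD.
Qed.

Lemma ket_act_ket (a : shift_sum R) (k : int) :
  ket_act hbar delta a (ket R k) =
  \sum_(n <- msupp a) a@_n (((k - n)%:~R + delta) * hbar) *: ket R (k - n).
Proof.
rewrite /ket_act /ket (@sum_msuppU _ _ _ (fun (k : int) (x : R[i]) =>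
  x *: \sum_(n <- msupp a)
         a@_n (((k - n)%:~R + delta) * hbar) *: ket R (k - n))).
  by rewrite scale1r.
by move=> j; rewrite scale0r.
Qed.

Lemma ket_actDr (a : shift_sum R) :
  {morph ket_act hbar delta a : v w / v + w}.
Proof.
move=> v w; apply: (@sum_msuppD _ _ _ (fun (k : int) (x : R[i]) =>
  x *: \sum_(n <- msupp a)
         a@_n (((k - n)%:~R + delta) * hbar) *: ket R (k - n))).
  by move=> j; rewrite scale0r.
by move=> j x y; rewrite scalerDl.
Qed.

Lemma ket_actU_ket (g : R -> R[i]) (n k : int) :
  ket_act hbar delta << g *g n >> (ket R k) =
  g (((k - n)%:~R + delta) * hbar) *: ket R (k - n).
Proof.
rewrite ket_act_ket (@sum_msuppU _ _ _ (fun (n : int) (g : R -> R[i]) =>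
   g (((k - n)%:~R + delta) * hbar) *: ket R (k - n))) // => j.
by rewrite scale0r.
Qed.

Lemma Aplus_ket (f : R -> R[i]) (n : int) :
  ket_act hbar delta (Aplus hbar f) (ket R n) =
  f ((n%:~R + 2^-1 + delta) * hbar) *: ket R (n + 1).
Proof.
rewrite ket_actU_ket opprK -mulrBl rmorphD /=; congr (f (_ * _) *: _).
by field.
Qed.

Lemma Aminus_ket (f : R -> R[i]) (n : int) :
  ket_act hbar delta (Aminus hbar f) (ket R n) =
  f ((n%:~R - 2^-1 + delta) * hbar) *: ket R (n - 1).
Proof.
rewrite ket_actU_ket -mulrDl rmorphB /=; congr (f (_ * _) *: _).
by field.
Qed.

End OperationFormulas.

(* Main.v *)
(* A ladder operator carries |n> to a multiple of a neighbouring ket, and the *)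
(* coefficient of both transitions |n> <-> |n+1> is f((n+1/2+delta)hbar).     *)
(* Call two indices linked if none of the transitions between them vanishes.  *)
(* The generated module reaches every ket linked to its generator.            *)
(* Conversely, the shift sums that only connect linked indices form a shift   *)
(* subalgebra, because linkedness is symmetric (for the involution) and       *)
(* transitive (for the product); it contains the ladder operators, so the     *)
(* module generated by |k> is spanned by the kets linked to |k>. The zeros of *)
(* f in each case determine which indices these are.                          *)
Require Import Defs.
From mathcomp Require Import all_boot all_order all_algebra.
From mathcomp Require Import boolp classical_sets functions reals.
From mathcomp Require Import complex.
From mathcomp Require Import zify ring.
From mathcomp.multinomials Require Import monalg.

Set Implicit Arguments.
Unset Strict Implicit.
Unset Printing Implicit Defensive.

Import Order.TTheory GRing.Theory Num.Theory.
Local Open Scope classical_set_scope.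
Local Open Scope ring_scope.

Section LinearSubspace.
Variables (K : pzRingType) (M : lmodType K).
Implicit Types V : set M.

Definition linear_subspace V : Prop :=
  [/\ V 0,
      forall v w, V v -> V w -> V (v + w)
    & forall (c : K) v, V v -> V (c *: v)].

Lemma linear_subspace_sum V (I : eqType) (r : seq I) (v : I -> M) :
  linear_subspace V -> (forall i, i \in r -> V (v i)) ->
  V (\sum_(i <- r) v i).
Proof. by move=> [V0 VD _] Vv; rewrite big_seq; apply: big_ind. Qed.

End LinearSubspace.

Section KetSums.
Variable R : realType.
Implicit Types (P : set int) (V : set (ket_space R)).

Lemma linear_subspace_ket_sums P : linear_subspace (@ket_sums R P).
Proof.
split=> [n | v w Pv Pw n | c v Pv n]; first by rewrite mcoeff0 eqxx.
- rewrite mcoeffD; have [-> | /Pv //] := eqVneq v@_n 0.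
  by rewrite add0r; exact: Pw.
- rewrite mcoeffZ => cv; apply: Pv; apply: contra_neq cv => ->.
  exact: mulr0.
Qed.

Lemma ket_sums_ket P n : P n -> ket_sums P (ket R n).
Proof.
by move=> Pn k; rewrite mcoeffU; have [<- // | _] := eqVneq n k; rewrite eqxx.
Qed.

Lemma scaler_ket (c : R[i]) n : c *: ket R n = << c *g n >>.
Proof. by apply/malgP => k; rewrite mcoeffZ !mcoeffU mulr_natr. Qed.

Lemma ket_sums_sub P V :
  linear_subspace V -> (forall n, P n -> V (ket R n)) -> ket_sums P `<=` V.
Proof.
move=> V_lin Vket v Pv; case: (V_lin) => _ _ VZ; rewrite [v]monalgE.
apply: linear_subspace_sum => // k; rewrite -mcoeff_neq0 => /Pv Pk.
by rewrite -scaler_ket; apply: VZ; exact: Vket.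
Qed.

End KetSums.

Section ShiftCoefficients.
Variables (R : realType) (hbar delta : R).
Implicit Types (g : R -> R[i]) (a : shift_sum R) (k n : int).

Lemma mcoeff_shift_lmul g a n :
  (shift_lmul hbar g a)@_n = (fun u => g u * a@_n u).
Proof.
have lmul0 : shift_lmul hbar g 0 = 0.
  by apply: (addrI (shift_lmul hbar g 0)); rewrite -shift_mulDr !addr0.
rewrite [in LHS](monalgE a).
rewrite (big_morph (shift_lmul hbar g) (shift_mulDr hbar _) lmul0).
rewrite -[RHS]/(g * a@_n) [in RHS](monalgE a) !raddf_sum mulr_sumr.
apply: eq_bigr => k _ /=.
rewrite /shift_lmul shift_mulUU add0r !mcoeffU mulrnAr.
by congr (_ *+ _); apply/funext => u; rewrite mul0r addr0.
Qed.

(* The points at which the coefficients of a shift sum act: g U^n carries     *)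
(* |k+n> to g(site k) |k>.                                                    *)
Definition site k : R := (k%:~R + delta) * hbar.

Lemma siteD k n : site k + n%:~R * hbar = site (k + n).
Proof. by rewrite /site -mulrDl rmorphD /=; congr (_ * _); ring. Qed.

End ShiftCoefficients.

Section BlockDiagonal.
Variables (R : realType) (hbar delta : R) (F : set (R -> R[i])).
Variable E : int -> int -> Prop.
Hypotheses (F_alg : star_subalgebra F) (F_inv : hbar_invariant hbar F).
Hypotheses (E_sym : forall m n, E m n -> E n m).
Hypotheses (E_trans : forall m n p, E m n -> E n p -> E m p).
Implicit Types (g h : R -> R[i]) (a b : shift_sum R) (k l n : int).

Local Notation site := (site hbar delta).

Definition block_coeff n : set (R -> R[i]) :=
  [set g | F g /\ forall k, g (site k) != 0 -> E (k + n) k].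

Definition block_diagonal : set (shift_sum R) :=
  [set a | forall n, block_coeff n a@_n].

Lemma block_coeff0 n : block_coeff n 0.
Proof. by case: F_alg => F0 *; split=> // k; rewrite eqxx. Qed.

Lemma block_coeffD n g h :
  block_coeff n g -> block_coeff n h -> block_coeff n (g + h).
Proof.
case: F_alg => _ FD _ _ _ [Fg Eg] [Fh Eh]; split=> [|k]; first exact: FD.
have [gk0 | /Eg //] := eqVneq (g (site k)) 0.
by rewrite fctE gk0 add0r; exact: Eh.
Qed.

Lemma block_coeff_mull n g h :
  (forall h', F h' -> F (fun u => g u * h' u)) ->
  block_coeff n h -> block_coeff n (fun u => g u * h u).
Proof.
move=> gF [Fh Eh]; split=> [|k]; first exact: gF.
by rewrite mulf_eq0 negb_or => /andP[_ /Eh].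
Qed.

Lemma block_coeff_shift_mul k l g h : block_coeff k g -> block_coeff l h ->
  block_coeff (k + l) (fun u => g u * h (u + k%:~R * hbar)).
Proof.
case: F_alg => _ _ _ FM _ [Fg Eg] [Fh Eh]; split=> [|j].
  by apply: FM => //; exact: F_inv.
rewrite siteD mulf_eq0 negb_or addrA => /andP[/Eg Ejk /Eh Ejkl].
exact: E_trans Ejkl Ejk.
Qed.

Lemma block_coeff_shift_star n g : block_coeff n g ->
  block_coeff (- n) (fun u => (g (u - n%:~R * hbar))^*).
Proof.
case: F_alg => _ _ _ _ FC [Fg Eg]; split=> [|k].
  by apply: FC; have := F_inv (- n) Fg; rewrite rmorphN mulNr.
rewrite fmorph_eq0 -mulNr -rmorphN siteD => /Eg; rewrite subrK.
exact: E_sym.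
Qed.

Lemma block_diagonal0 : block_diagonal 0.
Proof. by move=> n; rewrite mcoeff0; exact: block_coeff0. Qed.

Lemma block_diagonalD a b :
  block_diagonal a -> block_diagonal b -> block_diagonal (a + b).
Proof. by move=> Ba Bb n; rewrite mcoeffD; exact: block_coeffD. Qed.

Lemma block_diagonalU n g : block_coeff n g -> block_diagonal << g *g n >>.
Proof.
move=> Bg k; rewrite mcoeffU; have [<- // | _] := eqVneq n k.
exact: block_coeff0.
Qed.

Lemma block_diagonal_lmul g a :
  (forall h, F h -> F (fun u => g u * h u)) ->
  block_diagonal a -> block_diagonal (shift_lmul hbar g a).
Proof.
by move=> gF Ba n; rewrite mcoeff_shift_lmul; exact: block_coeff_mull.
Qed.

Lemma block_diagonal_mul a b :
  block_diagonal a -> block_diagonal b -> block_diagonal (shift_mul hbar a b).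
Proof.
move=> Ba Bb; apply: (big_ind _ block_diagonal0 block_diagonalD) => k _.
apply: (big_ind _ block_diagonal0 block_diagonalD) => l _.
by apply: block_diagonalU; exact: block_coeff_shift_mul.
Qed.

Lemma block_diagonal_star a :
  block_diagonal a -> block_diagonal (shift_star hbar a).
Proof.
move=> Ba; apply: (big_ind _ block_diagonal0 block_diagonalD) => k _.
by apply: block_diagonalU; exact: block_coeff_shift_star.
Qed.

Lemma shift_subalgebra_block_diagonal : shift_subalgebra hbar F block_diagonal.
Proof.
case: F_alg => _ _ FZ FM _.
split=> [a Ba k | ]; first by case: (Ba k).
split; last by move=> g a Fg; apply: block_diagonal_lmul => h; exact: FM.
split.
- exact: block_diagonal0.
- exact: block_diagonalD.
- by move=> c a; apply: block_diagonal_lmul; exact: FZ.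
- exact: block_diagonal_mul.
- exact: block_diagonal_star.
Qed.

Lemma ket_act_block_diagonal k a (v : ket_space R) :
  block_diagonal a -> ket_sums (E k) v ->
  ket_sums (E k) (ket_act hbar delta a v).
Proof.
move=> Ba Ev; have S_lin := linear_subspace_ket_sums R (E k).
case: (S_lin) => S0 _ SZ.
apply: linear_subspace_sum => // j; rewrite -mcoeff_neq0 => /Ev Ekj; apply/SZ.
apply: linear_subspace_sum => // n _.
have [-> | ajn] := eqVneq (a@_n (site (j - n))) 0; first by rewrite scale0r.
case: (Ba n) => _ /(_ _ ajn); rewrite subrK => Ejn.
by apply/SZ; apply: ket_sums_ket; exact: E_trans Ekj Ejn.
Qed.

End BlockDiagonal.

Section Ladder.
Variables (R : realType) (hbar delta : R) (f : R -> R[i]).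
Implicit Types j k m n p M N : int.

Definition ladder_coeff n : R[i] := f ((n%:~R + 2^-1 + delta) * hbar).

Lemma ladder_coeff_pred n :
  f ((n%:~R - 2^-1 + delta) * hbar) = ladder_coeff (n - 1).
Proof. by rewrite /ladder_coeff rmorphB /=; congr (f (_ * _)); field. Qed.

Lemma Aminus_ket_succ n :
  ket_act hbar delta (Aminus hbar f) (ket R (n + 1)) =
  ladder_coeff n *: ket R n.
Proof. by rewrite Aminus_ket ladder_coeff_pred addrK. Qed.

Lemma ladder_coeff_site n :
  f (site hbar delta n + 2^-1 * hbar) = ladder_coeff n.
Proof. by rewrite /ladder_coeff -mulrDl addrAC. Qed.

Lemma ladder_coeff_site_pred n :
  f (site hbar delta n - 2^-1 * hbar) = ladder_coeff (n - 1).
Proof. by rewrite -ladder_coeff_pred -mulrBl addrAC. Qed.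

Definition linked m n : Prop :=
  forall j, m <= j < n \/ n <= j < m -> ladder_coeff j != 0.

Lemma linked_refl n : linked n n.
Proof. by move=> j; lia. Qed.

Lemma linked_sym m n : linked m n -> linked n m.
Proof. by move=> mn j /or_comm; exact: mn. Qed.

Lemma linked_trans m n p : linked m n -> linked n p -> linked m p.
Proof.
move=> mn np j j_mp.
have [j_mn | j_np] : (m <= j < n \/ n <= j < m) \/ (n <= j < p \/ p <= j < n).
- by lia.
- exact: mn.
- exact: np.
Qed.

Lemma linked_succ n : ladder_coeff n != 0 -> linked n (n + 1).
Proof. by move=> cn j jn; have -> : j = n by lia. Qed.

Lemma linked_le k n N :
  ladder_coeff N = 0 -> k <= N -> linked k n -> n <= N.
Proof.
move=> cN kN kn; rewrite leNgt; apply/negP => Nn.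
have /eqP [] // : ladder_coeff N != 0 by apply: kn; lia.
Qed.

Lemma linked_gt k n M : ladder_coeff M = 0 -> M < k -> linked k n -> M < n.
Proof.
move=> cM Mk kn; rewrite ltNge; apply/negP => nM.
have /eqP [] // : ladder_coeff M != 0 by apply: kn; lia.
Qed.

Lemma linked_lower_ray N :
  ladder_coeff N = 0 -> (forall n, n < N -> ladder_coeff n != 0) ->
  linked N = [set n | n <= N].
Proof.
move=> cN cn; apply/seteqP; split=> n /=; first exact: linked_le.
by move=> nN j jn; apply: cn; lia.
Qed.

Lemma linked_upper_ray M :
  ladder_coeff (M - 1) = 0 -> (forall n, M <= n -> ladder_coeff n != 0) ->
  linked M = [set n | M <= n].
Proof.
move=> cM cn; apply/seteqP; split=> n /=.
- by move=> /(linked_gt cM); lia.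
- by move=> Mn j jn; apply: cn; lia.
Qed.

Lemma linked_interval M N k :
  ladder_coeff (M - 1) = 0 -> ladder_coeff N = 0 ->
  (forall n, M <= n < N -> ladder_coeff n != 0) -> M <= k <= N ->
  linked k = [set n | M <= n <= N].
Proof.
move=> cM cN cn kMN; apply/seteqP; split=> n /=.
- move=> kn; have := linked_le cN _ kn; have := linked_gt cM _ kn; lia.
- by move=> nMN j jn; apply: cn; lia.
Qed.

End Ladder.

Section KetModule.
Variables (R : realType) (hbar delta : R) (F : set (R -> R[i])) (f : R -> R[i]).
Hypotheses (F_alg : star_subalgebra F) (F_inv : hbar_invariant hbar F).
Hypothesis Ff_plus : F (fun u => f (u + 2^-1 * hbar)).
Hypothesis Ff_minus : F (fun u => f (u - 2^-1 * hbar)).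
Implicit Types k n : int.

Local Notation linked := (linked hbar delta f).
Local Notation ladder_coeff := (ladder_coeff hbar delta f).

Lemma Ahbar_block_diagonal :
  Ahbar hbar F f `<=` block_diagonal hbar delta F linked.
Proof.
move=> a; apply; split.
  apply: shift_subalgebra_block_diagonal => //.
  - exact: linked_sym.
  - exact: linked_trans.
move=> _ [] ->; apply: block_diagonalU => //; split=> // n.
- rewrite ladder_coeff_site_pred => /linked_succ.
  by rewrite subrK.
- rewrite ladder_coeff_site => /linked_succ.
  exact: linked_sym.
Qed.

Lemma ket_module_sub k :
  ket_module hbar delta F f k `<=` @ket_sums R (linked k).
Proof.
move=> v; apply; split; last first.
  by move=> _ ->; apply: ket_sums_ket; exact: linked_refl.
have [S0 SD SZ] := linear_subspace_ket_sums R (linked k); split=> // a w.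
move=> /Ahbar_block_diagonal; apply: ket_act_block_diagonal.
exact: linked_trans.
Qed.

Section InvariantSubspace.
Variable V : set (ket_space R).
Hypothesis V_inv : invariant_subspace hbar delta (Ahbar hbar F f) V.

Lemma invariant_subspace_linear : linear_subspace V.
Proof. by case: V_inv. Qed.

Lemma invariant_ket_succ n :
  ladder_coeff n != 0 -> V (ket R n) <-> V (ket R (n + 1)).
Proof.
case: V_inv => _ _ VZ VA cn; split=> Vn; rewrite -[ket R _]scale1r.
- rewrite -(mulVf cn) -scalerA -Aplus_ket; apply/VZ/VA => // A [_].
  by apply; left.
- rewrite -(mulVf cn) -scalerA -Aminus_ket_succ; apply/VZ/VA => // A [_].
  by apply; right.
Qed.

Lemma invariant_ket_linked_addn m (d : nat) :
  linked m (m + d%:Z) -> V (ket R m) <-> V (ket R (m + d%:Z)).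
Proof.
elim: d => [|d IHd] m_lnk; first by rewrite addr0.
have -> : m + d.+1%:Z = m + d%:Z + 1 by lia.
apply: iff_trans (invariant_ket_succ _); last by apply: m_lnk; lia.
by apply: IHd => j jd; apply: m_lnk; lia.
Qed.

Lemma invariant_ket_linked m n : linked m n -> V (ket R m) -> V (ket R n).
Proof.
have [mn | /ltW nm] := leP m n.
- have -> : n = m + `|n - m|%N by lia.
  by move=> /invariant_ket_linked_addn ->.
- have -> : m = n + `|m - n|%N by lia.
  by move=> /linked_sym /invariant_ket_linked_addn <-.
Qed.

End InvariantSubspace.

Lemma ket_moduleE k : ket_module hbar delta F f k = @ket_sums R (linked k).
Proof.
apply/seteqP; split; first exact: ket_module_sub.
move=> v kv V [V_inv Vk]; move: v kv.
apply: ket_sums_sub; first exact: invariant_subspace_linear V_inv.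
by move=> n /(invariant_ket_linked V_inv); apply; exact: Vk.
Qed.

End KetModule.

Theorem proposition4p3 (R : realType) (hbar delta : R)
    (F : set (R -> R[i])) (f : R -> R[i])
    (hbar_gt0 : 0 < hbar)
    (F_alg : star_subalgebra F)
    (F_inv : hbar_invariant hbar F)
    (F_sep : separates_points F)
    (Ff : F f)
    (Ff_plus : F (fun u => f (u + 2^-1 * hbar)))
    (Ff_minus : F (fun u => f (u - 2^-1 * hbar))) :
  (forall N : int,
     f ((N%:~R + 2^-1 + delta) * hbar) = 0 ->
     (forall n : int, n < N -> f ((n%:~R + 2^-1 + delta) * hbar) <> 0) ->
     ket_module hbar delta F f N = @ket_sums R [set n : int | n <= N]) /\
  (forall M : int,
     f ((M%:~R - 2^-1 + delta) * hbar) = 0 ->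
     (forall n : int, M < n -> f ((n%:~R - 2^-1 + delta) * hbar) <> 0) ->
     ket_module hbar delta F f M = @ket_sums R [set n : int | M <= n]) /\
  (forall M N : int,
     M < N ->
     f ((M%:~R - 2^-1 + delta) * hbar) = 0 ->
     f ((N%:~R + 2^-1 + delta) * hbar) = 0 ->
     (forall n : int, M <= n -> n < N ->
        f ((n%:~R + 2^-1 + delta) * hbar) <> 0) ->
     ket_module hbar delta F f M = ket_module hbar delta F f N /\
     ket_module hbar delta F f N = @ket_sums R [set n : int | M <= n <= N]).
Proof.
split; [|split].
- move=> N cN cn; rewrite ket_moduleE // linked_lower_ray // => n nN.
  by apply/eqP; exact: cn.
- move=> M; rewrite ladder_coeff_pred => cM cn.
  rewrite ket_moduleE // linked_upper_ray // => n Mn; apply/eqP.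
  by rewrite -(addrK 1 n) -ladder_coeff_pred; apply: cn; lia.
- move=> M N MN; rewrite ladder_coeff_pred => cM cN cn.
  have c_inside n : M <= n < N -> ladder_coeff hbar delta f n != 0.
    by move=> /andP[Mn nN]; apply/eqP; exact: cn.
  by rewrite !ket_moduleE // !(linked_interval cM cN c_inside) //; lia.
Qed.
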